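(* Let $G$ be a finite simple connected graph with $n$ vertices and $m$ edges, let $A(G)\subset V(G)\times V(G)$ be a set of arcs with $A(G)\cup A(G)^{-1}=D(G)$, and let $\theta: D(G)\to\mathbb{C}$ satisfy $\theta(e^{-1})=-\theta(e)$ for every $e\in A(G)$ and $\theta(e)=0$ for every $e\in A(G)\cap A(G)^{-1}$. Then, as formal power series in $u$, \[ {\bf Z}_\theta(u)=\prod_{[C]}\big(1-w(C)u^{|C|}\big)^{-1}=\exp\Big(\sum_{k=1}^\infty\frac{N_k}{k}u^k\Big), \] where $[C]$ runs over all equivalence classes of prime cycles of $G$ and $N_k=\sum\{w(C): C \text{ a cycle of length } k \text{ in } G\}$.
   Context: $D(G)=\{(u,v),(v,u): uv\in E(G)\}$ is the set of $2m$ arcs of $G$; for $e=(u,v)$, $o(e)=u$, $t(e)=v$, $e^{-1}=(v,u)$, and $A(G)^{-1}=\{e^{-1}:e\in A(G)\}$. The twisted Grover matrix ${\bf U}_\theta$ is the $2m\times2m$ matrix indexed by $D(G)$ with $(e,f)$-entry $2e^{-i\theta(e)}/\deg t(f)$ if $t(f)=o(e)$ and $f\ne e^{-1}$; $e^{-i\theta(e)}(2/\deg t(f)-1)$ if $f=e^{-1}$; $0$ otherwise. ${\bf Z}_\theta(u)^{-1}=\det({\bf I}_{2m}-u{\bf U}_\theta)$. Weight: $w(e,f)=2e^{-i\theta(f)}/\deg t(e)$ if $t(e)=o(f)$ and $f\ne e^{-1}$; $w(e,f)=e^{-i\theta(f)}(2/\deg t(e)-1)$ if $f=e^{-1}$;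 $w(e,f)=0$ otherwise. A cycle of length $r$ is a sequence $C=(e_1,\ldots,e_r)$ of arcs with $t(e_i)=o(e_{i+1})$ for $1\le i\le r-1$ and $t(e_r)=o(e_1)$ (backtracking allowed); $|C|=r$ and $w(C)=w(e_1,e_2)\cdots w(e_{r-1},e_r)w(e_r,e_1)$. Two cycles are equivalent if one is a cyclic shift of the other. $C^l$ denotes the cycle going $l$ times around $C$; a cycle is prime if it is not of the form $B^l$ with $l\ge2$ for a cycle $B$. *)

(* Defs.v *)
From HB Require Import structures.
From mathcomp Require Import all_boot all_order all_algebra.
From mathcomp Require Import generic_quotient finmap boolp reals.
From mathcomp Require Import sequences exp trigo.
From mathcomp.real_closed Require Import complex.

Set Implicit Arguments.
Unset Strict Implicit.
Unset Printing Implicit Defensive.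

Import GRing.Theory.
Local Open Scope ring_scope.

Record fps (F : Type) := Fps { fps_coef : nat -> F }.

Lemma fpsP (F : Type) (f g : fps F) :
  (forall n, fps_coef f n = fps_coef g n) -> f = g.
Proof. by case: f g => [f] [g] /= fg; congr Fps; apply/funext. Qed.

HB.instance Definition _ (F : Type) := gen_eqMixin (fps F).
HB.instance Definition _ (F : Type) := gen_choiceMixin (fps F).

Section FpsRing.
Variable F : fieldType.
Implicit Types f g h : fps F.

Definition fps_zero : fps F := Fps (fun _ => 0).
Definition fps_opp f : fps F := Fps (fun n => - fps_coef f n).
Definition fps_add f g : fps F := Fps (fun n => fps_coef f n + fps_coef g n).

Lemma fps_addA : associative fps_add.
Proof. by move=> f g h; apply: fpsP => n /=; rewrite addrA. Qed.
Lemma fps_addC : commutative fps_add.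
Proof. by move=> f g; apply: fpsP => n /=; rewrite addrC. Qed.
Lemma fps_add0 : left_id fps_zero fps_add.
Proof. by move=> f; apply: fpsP => n /=; rewrite add0r. Qed.
Lemma fps_addN : left_inverse fps_zero fps_opp fps_add.
Proof. by move=> f; apply: fpsP => n /=; rewrite addNr. Qed.

HB.instance Definition _ := GRing.isZmodule.Build (fps F)
  fps_addA fps_addC fps_add0 fps_addN.

Definition fpsC (a : F) : fps F := Fps (fun n => if n == 0%N then a else 0).
Definition fpsX : fps F := Fps (fun n => (n == 1%N)%:R).

Definition fps_mul f g : fps F :=
  Fps (fun n => \sum_(i < n.+1) fps_coef f i * fps_coef g (n - i)).

Definition fps_trunc n f : {poly F} := \poly_(i < n.+1) fps_coef f i.

Lemma fps_truncE n f i : (i <= n)%N -> (fps_trunc n f)`_i = fps_coef f i.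
Proof. by move=> le_in; rewrite coef_poly ltnS le_in. Qed.

Lemma fps_mul_trunc n f g i : (i <= n)%N ->
  fps_coef (fps_mul f g) i = (fps_trunc n f * fps_trunc n g)`_i.
Proof.
move=> le_in; rewrite coefM; apply: eq_bigr => j _.
rewrite !fps_truncE //; first exact: leq_trans (leq_subr _ _) le_in.
by apply: leq_trans le_in; rewrite -ltnS.
Qed.

Lemma fps_mulC : commutative fps_mul.
Proof.
by move=> f g; apply: fpsP => n; rewrite !(fps_mul_trunc _ _ (leqnn n)) mulrC.
Qed.

Lemma fps_mulA : associative fps_mul.
Proof.
move=> f g h; apply: fpsP => n; rewrite !(fps_mul_trunc _ _ (leqnn n)).
have congl (p q r : {poly F}) : (forall i, (i <= n)%N -> p`_i = q`_i) ->
    (p * r)`_n = (q * r)`_n.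
  by move=> pq; rewrite !coefM; apply: eq_bigr => i _; rewrite pq // -ltnS.
rewrite mulrC (congl (fps_trunc n (fps_mul g h))
  (fps_trunc n g * fps_trunc n h)); last first.
  by move=> i le_in; rewrite fps_truncE // (fps_mul_trunc _ _ le_in).
rewrite mulrC mulrA; apply/esym/congl => i le_in.
by rewrite fps_truncE // (fps_mul_trunc _ _ le_in).
Qed.

Lemma fps_mul1 : left_id (fpsC 1) fps_mul.
Proof.
move=> f; apply: fpsP => n /=; rewrite big_ord_recl /= mul1r subn0.
rewrite big1 ?addr0//; by move=> i _; rewrite mul0r.
Qed.

Lemma fps_mulDl : left_distributive fps_mul fps_add.
Proof.
move=> f g h; apply: fpsP => n /=; rewrite -big_split /=.
by apply: eq_bigr => i _; rewrite mulrDl.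
Qed.

Lemma fps_1_neq0 : fpsC 1 != 0.
Proof.
by apply/eqP => /(congr1 (fun f => fps_coef f 0)) /= /eqP; rewrite oner_eq0.
Qed.

HB.instance Definition _ := GRing.Zmodule_isComNzRing.Build (fps F)
  fps_mulA fps_mulC fps_mul1 fps_mulDl fps_1_neq0.

Lemma fps_coef0 n : fps_coef (0 : fps F) n = 0. Proof. by []. Qed.
Lemma fps_coef1 n : fps_coef (1 : fps F) n = (n == 0%N)%:R.
Proof. by case: n. Qed.
Lemma fps_coefC a n : fps_coef (fpsC a) n = if n == 0%N then a else 0.
Proof. by []. Qed.
Lemma fps_coefX n : fps_coef fpsX n = (n == 1%N)%:R. Proof. by []. Qed.
Lemma fps_coefN f n : fps_coef (- f) n = - fps_coef f n. Proof. by []. Qed.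
Lemma fps_coefD f g n : fps_coef (f + g) n = fps_coef f n + fps_coef g n.
Proof. by []. Qed.
Lemma fps_coefM f g n :
  fps_coef (f * g) n = \sum_(i < n.+1) fps_coef f i * fps_coef g (n - i).
Proof. by []. Qed.
Lemma fps_coef_sum (I : Type) (r : seq I) (P : pred I) (E : I -> fps F) n :
  fps_coef (\sum_(i <- r | P i) E i) n = \sum_(i <- r | P i) fps_coef (E i) n.
Proof. by elim/big_rec2: _ => // i x y _ <-. Qed.
Lemma fps_coefCM a f n : fps_coef (fpsC a * f) n = a * fps_coef f n.
Proof.
rewrite fps_coefM big_ord_recl subn0 big1 ?addr0// => i _.
by rewrite mul0r.
Qed.

Lemma fps_coefX_small h j n : fps_coef h 0 = 0 -> (n < j)%N ->
  fps_coef (h ^+ j) n = 0.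
Proof.
move=> h0; elim: j n => // j IHj n ltnj; rewrite exprS fps_coefM big1 // => i _.
have [->|i_gt0] := posnP i; first by rewrite h0 mul0r.
rewrite IHj ?mulr0//; apply: (@leq_trans n) => //.
by rewrite ltn_subrL i_gt0 (leq_trans i_gt0) // -ltnS.
Qed.

(* 1/f = f_0^-1 * \sum_j (1 - f/f_0)^j for f_0 != 0; the terms with j > n do
   not contribute to the coefficient of u^n. *)
Definition fps_unit : pred (fps F) := fun f => fps_coef f 0 != 0.
Definition fps_inv f : fps F :=
  if fps_unit f then
    let a := (fps_coef f 0)^-1 in
    Fps (fun n => a * \sum_(j < n.+1) fps_coef ((1 - fpsC a * f) ^+ j) n)
  else f.

Lemma fps_mulVx : {in fps_unit, left_inverse 1 fps_inv *%R}.
Proof.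
move=> f f0; rewrite /fps_inv (f0 : fps_unit f) mulrC.
set a := _^-1; set h := 1 - fpsC a * f; set S := Fps _.
have h0 : fps_coef h 0 = 0.
  by rewrite fps_coefD fps_coefN fps_coefCM fps_coef1 /= mulVf ?subrr.
apply: fpsP => n.
have -> : fps_coef (f * S) n =
    fps_coef ((fpsC a * f) * \sum_(j < n.+1) h ^+ j) n.
  rewrite [fpsC a * f]mulrC -mulrA !fps_coefM; apply: eq_bigr => i _.
  rewrite fps_coefCM fps_coef_sum /=; congr (_ * (_ * _)).
  rewrite (big_ord_widen n.+1 (fun j => fps_coef (h ^+ j) (n - i))); last first.
    by rewrite ltnS leq_subr.
  rewrite big_mkcond /=; apply: eq_bigr => j _.
  by case: ltnP => // ?; rewrite fps_coefX_small.
have -> : fpsC a * f = 1 - h by rewrite /h opprB addrC subrK.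
rewrite -[1 - h]opprB mulNr -subrX1 opprB fps_coefD fps_coefN.
by rewrite fps_coefX_small ?subr0.
Qed.

Lemma fps_unitPl f g : g * f = 1 -> fps_unit f.
Proof.
move=> /(congr1 (fun f => fps_coef f 0)); rewrite fps_coefM big_ord1 /= => gf.
by apply/eqP => f0; move/eqP: gf; rewrite f0 mulr0 eq_sym oner_eq0.
Qed.

Lemma fps_inv_out : {in [predC fps_unit], fps_inv =1 id}.
Proof.
by move=> f; rewrite inE /fps_inv => /negbTE; rewrite /in_mem /= => ->.
Qed.

HB.instance Definition _ := GRing.ComNzRing_hasMulInverse.Build (fps F)
  fps_mulVx fps_unitPl fps_inv_out.

(* exp f = \sum_j f^j / j!, for f without constant term (for other f the
   value is meaningless); the terms with j > n do not contribute to the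
   coefficient of u^n. *)
Definition fps_exp f : fps F :=
  Fps (fun n => \sum_(j < n.+1) fps_coef (f ^+ j) n / (j`!)%:R).

(* P is the formal product of the family E: every coefficient of the finite
   partial products is eventually equal to that of P, along the finite subsets
   of I ordered by inclusion. *)
Definition fps_is_prod (I : choiceType) (E : I -> fps F) (P : fps F) : Prop :=
  forall n, exists S0 : {fset I}, forall S : {fset I}, (S0 `<=` S)%fset ->
    fps_coef (\prod_(i <- S) E i) n = fps_coef P n.

End FpsRing.

Arguments fpsX {F}.

Definition cexp (R : realType) (z : R[i]) : R[i] :=
  let: (x +i* y)%C := z in (expR x * cos y +i* (expR x * sin y))%C.

Record sgraph := SGraph {
  vertex :> finType;
  adj : rel vertex;
  adj_sym : symmetric adj;
  adj_irr : irreflexive adj }.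

Definition connected_graph (G : sgraph) : Prop :=
  (0 < #|G|)%N /\ forall x y : G, connect (@adj G) x y.

Definition arcs (G : sgraph) : {set G * G} := [set p | adj p.1 p.2].

Definition rev_arcs (G : sgraph) (A : {set G * G}) : {set G * G} :=
  [set (p.2, p.1) | p in A].

Definition degree (G : sgraph) (x : G) : nat := #|[set y | adj x y]|.

Section Arcs.
Variable G : sgraph.

(* The set D(G) as a type; its cardinal is 2m. *)
Definition darc := {p : G * G | p \in arcs G}.

Definition org (e : darc) : G := (val e).1.
Definition tgt (e : darc) : G := (val e).2.

Lemma inv_arc_subproof (e : darc) : (tgt e, org e) \in arcs G.
Proof. by have := valP e; rewrite !inE adj_sym. Qed.
Definition inv_arc (e : darc) : darc :=
  exist _ (tgt e, org e) (inv_arc_subproof e).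

Definition is_cycle (C : seq darc) : bool :=
  (C != [::]) && path.cycle (fun e f => tgt e == org f) C.

Definition cycle_pow (C : seq darc) (l : nat) : seq darc := flatten (nseq l C).

Definition prime_cycle (C : seq darc) : Prop :=
  is_cycle C /\
  ~ exists B l, [/\ is_cycle B, (2 <= l)%N & C = cycle_pow B l].

Definition primeCycle := {C : seq darc | `[< prime_cycle C >]}.

(* rot i C is C itself for i >= size C. *)
Definition cycle_equiv (C C' : primeCycle) : bool :=
  `[< exists i, val C' = rot i (val C) >].

Lemma cycle_equiv_refl : reflexive cycle_equiv.
Proof. by move=> C; apply/asboolP; exists 0%N; rewrite rot0. Qed.

Lemma cycle_equiv_sym : symmetric cycle_equiv.
Proof.
suff imp C C' : cycle_equiv C C' -> cycle_equiv C' C.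
  by move=> C C'; apply/idP/idP; apply: imp.
case/asboolP=> i eqC'; apply/asboolP; exists (size (val C') - i)%N.
by rewrite -/(rotr i (val C')) eqC' rotK.
Qed.

Lemma cycle_equiv_trans : transitive cycle_equiv.
Proof.
move=> C2 C1 C3 /asboolP[i eq2] /asboolP[j eq3]; apply/asboolP.
by exists (rot_add (val C1) i j); rewrite eq3 eq2 rot_rot_add.
Qed.

Canonical cycle_equiv_rel :=
  EquivRel cycle_equiv cycle_equiv_refl cycle_equiv_sym cycle_equiv_trans.

Definition primeClass := {eq_quot cycle_equiv_rel}%qT.

Definition class_rep (c : primeClass) : seq darc := val (repr c).

End Arcs.

Section Twisted.
Variables (R : realType) (G : sgraph) (theta : darc G -> R[i]).

Definition grover_entry (e f : darc G) : R[i] :=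
  if (tgt f == org e) && (f != inv_arc e) then
    2 * cexp (- ('i * theta e)) / (degree (tgt f))%:R
  else if f == inv_arc e then
    cexp (- ('i * theta e)) * (2 / (degree (tgt f))%:R - 1)
  else 0.

Definition grover_mx : 'M[R[i]]_#|{: darc G}| :=
  \matrix_(i, j) grover_entry (enum_val i) (enum_val j).

Definition twisted_zeta : fps R[i] :=
  (\det (1%:M - fpsX *: map_mx (@fpsC _) grover_mx))^-1.

Definition arc_weight (e f : darc G) : R[i] :=
  if (tgt e == org f) && (f != inv_arc e) then
    2 * cexp (- ('i * theta f)) / (degree (tgt e))%:R
  else if f == inv_arc e then
    cexp (- ('i * theta f)) * (2 / (degree (tgt e))%:R - 1)
  else 0.

(* zip C (rot 1 C) lists the pairs (e_1, e_2), ..., (e_r, e_1). *)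
Definition cycle_weight (C : seq (darc G)) : R[i] :=
  \prod_(p <- zip C (rot 1 C)) arc_weight p.1 p.2.

Lemma cycle_weight_rot i (C : seq (darc G)) :
  cycle_weight (rot i C) = cycle_weight C.
Proof.
rewrite /cycle_weight rot_rot.
have -> : zip (rot i C) (rot i (rot 1 C)) = rot i (zip C (rot 1 C)).
  rewrite {1 2 4}/rot zip_cat ?size_drop ?size_rot //.
  have zip_drop j (s t : seq (darc G)) :
      zip (drop j s) (drop j t) = drop j (zip s t).
    by elim: j s t => [|j IHj] [|x s] [|y t] //=; case: drop.
  have zip_take j (s t : seq (darc G)) :
      zip (take j s) (take j t) = take j (zip s t).
    by elim: j s t => [|j IHj] [|x s] [|y t] //=; rewrite IHj.
  by rewrite zip_drop zip_take.
by apply: perm_big; rewrite perm_rot.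
Qed.

Definition cycle_sum (k : nat) : R[i] :=
  \sum_(C : k.-tuple (darc G) | is_cycle C) cycle_weight C.

Definition cycle_sum_series : fps R[i] :=
  Fps (fun k => if k == 0%N then 0 else cycle_sum k / k%:R).

Definition euler_factor (c : primeClass G) : fps R[i] :=
  (1 - fpsC (cycle_weight (class_rep c)) * fpsX ^+ size (class_rep c))^-1.

End Twisted.

(* Main.v *)
Require Import Defs.
From HB Require Import structures.
From mathcomp Require Import all_boot all_order all_algebra.
From mathcomp Require Import generic_quotient finmap boolp reals.
From mathcomp.real_closed Require Import complex.

Set Implicit Arguments.
Unset Strict Implicit.
Unset Printing Implicit Defensive.

Import GRing.Theory Num.Theory.
Local Open Scope ring_scope.
Local Arguments fps_coef : simpl never.

(* A unit power series over a field of characteristic 0 is determined by its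
   constant term and its logarithmic derivative, so it suffices to see that the
   three series have logarithmic derivative \sum_k N_k u^k for u d/du.
   - If W is the matrix of arc weights, N_k is the trace of W^k, because words
     of arcs that are not cycles have weight 0.  As the inverse of 1 - uW is
     \sum_k u^k W^k, Jacobi's formula gives -\sum_k N_k u^k for det(1 - uW).
   - For the exponential this is the definition of the exponent.
   - An Euler factor contributes \sum_j |C| w(C)^j u^(j |C|).  A cycle of length
     k is in exactly one way a power of a rotation of a representative C, with
     |C| rotations for each class, so N_k is the sum of |C| w(C)^(k / |C|) over
     the classes with |C| dividing k.  The uniqueness of primitive roots rests
     on the fact that two commuting words are powers of a common word. *)

Definition derivation (R : pzRingType) (d : R -> R) : Prop :=
  forall x y, d (x * y) = d x * y + x * d y.

Section Derivation.
Variables (R : comNzRingType) (d : {additive R -> R}).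
Hypothesis dM : derivation d.

Lemma derivation_nat m : d m%:R = 0.
Proof.
suff d1 : d 1 = 0 by rewrite raddfMn /= d1 mul0rn.
by apply: (@addrI _ (d 1)); rewrite addr0 -{3}[1]mulr1 dM mulr1 mul1r.
Qed.

Lemma derivationX x m : d (x ^+ m.+1) = x ^+ m * d x *+ m.+1.
Proof.
elim: m => [|m IHm]; first by rewrite mul1r.
rewrite exprS dM IHm mulrnAr mulrA -exprS [d x * _]mulrC.
by rewrite -mulrS.
Qed.

Lemma derivation_prod (I : eqType) (r : seq I) (x : I -> R) : uniq r ->
  d (\prod_(i <- r) x i) =
  \sum_(i <- r) \prod_(j <- r) (if j == i then d (x j) else x j).
Proof.
elim: r => [_|i r IHr /= /andP[ri Ur]].
  by rewrite !big_nil (derivation_nat 1).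
rewrite !big_cons dM eqxx IHr // mulr_sumr; congr (_ * _ + _).
  by apply: eq_big_seq => j rj; case: eqP => // ji; rewrite -ji rj in ri.
apply: eq_big_seq => k rk; rewrite big_cons.
by case: eqP => // ik; rewrite ik rk in ri.
Qed.

Lemma derivation_det n (M : 'M[R]_n) :
  d (\det M) = \tr (map_mx d M *m \adj M).
Proof.
pose derive_row i := \matrix_(k, j) (if k == i then d (M k j) else M k j).
transitivity (\sum_i \det (derive_row i)).
  rewrite /determinant raddf_sum exchange_big; apply: eq_bigr => s _ /=.
  rewrite raddfMsign derivation_prod ?index_enum_uniq // mulr_sumr.
  apply: eq_bigr => i _; congr (_ * _); apply: eq_bigr => k _.
  by rewrite mxE.
apply: eq_bigr => i _; rewrite (expand_det_row _ i) mxE.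
apply: eq_bigr => j _; rewrite !mxE eqxx; congr (_ * (_ * \det _)).
by apply/matrixP => k l; rewrite !mxE eq_sym (negPf (neq_lift _ _)).
Qed.
End Derivation.

Definition logderiv (R : unitRingType) (d : R -> R) (x : R) : R := d x / x.

Section LogDerivative.
Variables (R : comUnitRingType) (d : {additive R -> R}).
Hypothesis dM : derivation d.

Lemma mul_logderiv x : x \is a GRing.unit -> x * logderiv d x = d x.
Proof. by move=> Ux; rewrite mulrC divrK. Qed.

Lemma logderiv1 : logderiv d 1 = 0.
Proof. by rewrite /logderiv (derivation_nat dM 1) mul0r. Qed.

Lemma logderivM x y : x \is a GRing.unit -> y \is a GRing.unit ->
  logderiv d (x * y) = logderiv d x + logderiv d y.
Proof.
move=> Ux Uy; rewrite /logderiv dM invrM // mulrDl; congr (_ + _).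
  by rewrite mulrA mulrK.
by rewrite [x * _]mulrC mulrA mulrAC mulrK.
Qed.

Lemma logderivV x : x \is a GRing.unit -> logderiv d x^-1 = - logderiv d x.
Proof.
move=> Ux; apply/eqP; rewrite -addr_eq0 -logderivM ?unitrV //.
by rewrite mulVr // logderiv1.
Qed.

Lemma logderiv_prod (I : Type) (r : seq I) (E : I -> R) :
    (forall i, E i \is a GRing.unit) ->
  logderiv d (\prod_(i <- r) E i) = \sum_(i <- r) logderiv d (E i).
Proof.
move=> UE; elim: r => [|i r IHr]; first by rewrite !big_nil logderiv1.
by rewrite !big_cons logderivM ?IHr // rpred_prod.
Qed.

Lemma logderiv_det n (M : 'M[R]_n) : M \in unitmx ->
  logderiv d (\det M) = \tr (map_mx d M *m invmx M).
Proof.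
move=> UM; rewrite /logderiv (derivation_det dM) /invmx UM -scalemxAr.
by rewrite mxtraceZ mulrC.
Qed.
End LogDerivative.

Section FpsTheory.
Variable F : fieldType.
Implicit Types f g h : fps F.

Lemma fps_unitE f : (f \is a GRing.unit) = (fps_coef f 0 != 0).
Proof. by []. Qed.

Lemma fps_coefMn f m n : fps_coef (f *+ m) n = fps_coef f n *+ m.
Proof. by elim: m => [|m IHm]; rewrite ?mulr0n // !mulrS fps_coefD IHm. Qed.

Definition fps_const f : F := fps_coef f 0.

Lemma fps_const_is_zmod_morphism : zmod_morphism fps_const.
Proof. by []. Qed.

Lemma fps_const_is_monoid_morphism : monoid_morphism fps_const.
Proof. by split=> // f g; rewrite /fps_const fps_coefM big_ord1. Qed.

HB.instance Definition _ :=
  GRing.isZmodMorphism.Build (fps F) F fps_const fps_const_is_zmod_morphism.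
HB.instance Definition _ :=
  GRing.isMonoidMorphism.Build (fps F) F fps_const
    fps_const_is_monoid_morphism.

Lemma fps_coefXM f n :
  fps_coef (fpsX * f) n = if n is m.+1 then fps_coef f m else 0.
Proof.
rewrite fps_coefM; case: n => [|n]; first by rewrite big_ord1 mul0r.
rewrite !big_ord_recl big1 /= => [|i _]; last by rewrite mul0r.
by rewrite mul0r add0r addr0 mul1r subn1.
Qed.

Lemma fps_coefXnM l f n :
  fps_coef (fpsX ^+ l * f) n = if (n < l)%N then 0 else fps_coef f (n - l).
Proof.
elim: l n => [|l IHl] n; first by rewrite mul1r subn0.
by rewrite exprS -mulrA fps_coefXM; case: n => // n; rewrite IHl.
Qed.

(* X d/dX rather than d/dX, so that coefficients keep their index. *)
Definition fps_xderiv f : fps F := Fps (fun n => n%:R * fps_coef f n).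

Lemma fps_coef_xderiv f n : fps_coef (fps_xderiv f) n = n%:R * fps_coef f n.
Proof. by []. Qed.

Lemma fps_xderiv_is_zmod_morphism : zmod_morphism fps_xderiv.
Proof. by move=> f g; apply: fpsP => n; exact: mulrBr. Qed.

HB.instance Definition _ :=
  GRing.isZmodMorphism.Build (fps F) (fps F) fps_xderiv
    fps_xderiv_is_zmod_morphism.

Lemma fps_xderivM : derivation fps_xderiv.
Proof.
move=> f g; apply: fpsP => n; rewrite fps_coefD fps_coef_xderiv !fps_coefM.
rewrite mulr_sumr -big_split /=; apply: eq_bigr => i _.
rewrite !fps_coef_xderiv -mulrA [X in _ + X]mulrCA -mulrDl -natrD subnKC //.
by rewrite -ltnS.
Qed.

Lemma fps_xderivC a : fps_xderiv (fpsC a) = 0.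
Proof.
by apply: fpsP => -[|n]; rewrite fps_coef_xderiv ?mul0r // mulr0.
Qed.

Lemma fps_xderivX : fps_xderiv fpsX = fpsX.
Proof.
by apply: fpsP => -[|[|n]]; rewrite fps_coef_xderiv ?mul0r ?mul1r ?mulr0.
Qed.

Lemma fps_coef0_logderiv f : fps_coef (logderiv fps_xderiv f) 0 = 0.
Proof. by rewrite fps_coefM big_ord1 fps_coef_xderiv !mul0r. Qed.

Lemma fps_coef_eq_logderiv n f g :
    [pchar F] =i pred0 -> f \is a GRing.unit ->
    fps_coef f 0 = fps_coef g 0 ->
    (forall k, (k <= n)%N ->
       fps_coef (logderiv fps_xderiv f) k =
       fps_coef (logderiv fps_xderiv g) k) ->
  fps_coef f n = fps_coef g n.
Proof.
move=> F0 Uf fg0; have Ug : g \is a GRing.unit by rewrite fps_unitE -fg0.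
elim/ltn_ind: n => -[|n] IHn // eq_log; apply: (@mulfI _ n.+1%:R).
  by rewrite (pcharf0P _).1.
rewrite -!fps_coef_xderiv -(mul_logderiv _ Uf) -(mul_logderiv _ Ug).
rewrite !fps_coefM big_ord_recr [RHS]big_ord_recr /= subnn.
rewrite !fps_coef0_logderiv !mulr0 !addr0; apply: eq_bigr => i _.
rewrite eq_log ?leq_subr // IHn // => k le_ki.
by rewrite eq_log // (leq_trans le_ki) // ltnW.
Qed.

Lemma fps_logderiv_inj f g : [pchar F] =i pred0 -> f \is a GRing.unit ->
    fps_coef f 0 = fps_coef g 0 ->
    logderiv fps_xderiv f = logderiv fps_xderiv g ->
  f = g.
Proof.
move=> F0 Uf fg0 eq_log; apply: fpsP => n.
by apply: fps_coef_eq_logderiv => // k _; rewrite eq_log.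
Qed.

Lemma fps_coef0_exp h : fps_coef (fps_exp h) 0 = 1.
Proof. by rewrite [LHS]big_ord1 expr0 fps_coef1 divr1. Qed.

Lemma fps_coef_expM h g n m : fps_coef h 0 = 0 -> (n < m)%N ->
  fps_coef (fps_exp h * g) n = \sum_(j < m) fps_coef (h ^+ j * g) n / j`!%:R.
Proof.
move=> h0 ltnm; under [RHS]eq_bigr do rewrite fps_coefM mulr_suml.
rewrite fps_coefM exchange_big; apply: eq_bigr => i _ /=.
rewrite [fps_coef _ _](big_ord_widen m
  (fun j => fps_coef (h ^+ j) i / j`!%:R)); last first.
  exact: leq_trans (ltn_ord i) _.
rewrite big_mkcond mulr_suml; apply: eq_bigr => j _.
rewrite [RHS]mulrAC; case: ltnP => // ltij.
by rewrite fps_coefX_small // !mul0r.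
Qed.

Lemma fps_xderiv_exp h : [pchar F] =i pred0 -> fps_coef h 0 = 0 ->
  fps_xderiv (fps_exp h) = fps_exp h * fps_xderiv h.
Proof.
move=> F0 h0; apply: fpsP => n; rewrite (fps_coef_expM _ h0 (ltnSn n)).
rewrite fps_coef_xderiv -[fps_exp h]mulr1 (fps_coef_expM _ h0 (leqnSn n.+1)).
rewrite big_ord_recl mulr1 fps_coef1 mulrDr mulrA.
have -> : n%:R * (n == 0%N)%:R = 0 :> F.
  by case: n => [|n]; rewrite ?mul0r ?mulr0.
rewrite mul0r add0r mulr_sumr; apply: eq_bigr => j _.
rewrite mulr1 mulrA -fps_coef_xderiv lift0 (derivationX fps_xderivM).
rewrite fps_coefMn -[_ *+ _ in LHS]mulr_natr factS natrM.
by rewrite invfM mulrA mulfK // (pcharf0P _).1.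
Qed.

Lemma logderiv_exp h : [pchar F] =i pred0 -> fps_coef h 0 = 0 ->
  logderiv fps_xderiv (fps_exp h) = fps_xderiv h.
Proof.
move=> F0 h0; rewrite /logderiv fps_xderiv_exp // mulrAC mulrV ?mul1r //.
by rewrite fps_unitE fps_coef0_exp oner_eq0.
Qed.

Definition fps_geom (a : F) l : fps F :=
  Fps (fun n => if (l %| n)%N then a ^+ (n %/ l) else 0).

Lemma mul_fps_geom a l : (0 < l)%N ->
  (1 - fpsC a * fpsX ^+ l) * fps_geom a l = 1.
Proof.
move=> l_gt0; apply: fpsP => n.
rewrite mulrBl mul1r -mulrA fps_coefD fps_coefN fps_coefCM fps_coefXnM.
rewrite fps_coef1 /fps_coef /=; have [lt_nl | le_ln] := ltnP n l.
  rewrite mulr0 subr0; have [-> | n_gt0] := posnP n.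
    by rewrite dvdn0 div0n.
  by rewrite gtnNdvd // eqn0Ngt n_gt0.
rewrite -(subnK le_ln) addnK addn_eq0 (gtn_eqF l_gt0) andbF dvdn_addl //.
case: ifP => [l_dvd|_]; last by rewrite mulr0 subrr.
by rewrite divnDl // divnn l_gt0 addn1 exprS subrr.
Qed.

Lemma one_sub_CXn_unit a l : (0 < l)%N ->
  (1 - fpsC a * fpsX ^+ l : fps F) \is a GRing.unit.
Proof.
by move=> l_gt0; apply/unitrPr; exists (fps_geom a l); exact: mul_fps_geom.
Qed.

Lemma invr_one_sub_CXn a l : (0 < l)%N ->
  (1 - fpsC a * fpsX ^+ l)^-1 = fps_geom a l.
Proof.
move=> l_gt0; apply: (mulrI (one_sub_CXn_unit a l_gt0)).
by rewrite mulrV ?one_sub_CXn_unit // mul_fps_geom.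
Qed.

Lemma fps_coef_logderiv_geom a l n : (0 < l)%N -> (0 < n)%N ->
  fps_coef (logderiv fps_xderiv (fps_geom a l)) n =
  if (l %| n)%N then a ^+ (n %/ l) *+ l else 0.
Proof.
move=> l_gt0 n_gt0; set f := 1 - fpsC a * fpsX ^+ l.
have xderivf : fps_xderiv f = - (fpsC a * fpsX ^+ l *+ l).
  case: l l_gt0 @f => // l _ f.
  rewrite raddfB /= (derivation_nat fps_xderivM 1) sub0r fps_xderivM.
  rewrite fps_xderivC mul0r add0r (derivationX fps_xderivM) /= fps_xderivX.
  by rewrite mulrnAr -exprSr.
rewrite -invr_one_sub_CXn // (logderivV fps_xderivM) ?one_sub_CXn_unit //.
rewrite /logderiv /= xderivf mulNr opprK invr_one_sub_CXn // mulrnAl.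
have -> : fpsC a * fpsX ^+ l * fps_geom a l = fps_geom a l - 1.
  by rewrite -(mul_fps_geom a l_gt0) mulrBl mul1r subKr.
rewrite fps_coefMn fps_coefD fps_coefN fps_coef1.
rewrite eqn0Ngt n_gt0 subr0 /fps_coef /=; case: ifP => // _.
by rewrite mul0rn.
Qed.
End FpsTheory.

Arguments fps_xderiv {F} f.
Arguments fps_xderivM {F} x y.

Section CharacteristicSeries.
Variables (F : fieldType) (n : nat) (W : 'M[F]_n).

Let uW : 'M[fps F]_n := fpsX *: map_mx (@fpsC F) W.

Definition char_series_mx : 'M[fps F]_n := 1%:M - uW.

Definition char_series : fps F := \det char_series_mx.

Definition trace_series : fps F :=
  Fps (fun k => if k == 0%N then 0 else \tr (W ^+ k)).

Definition resolvent_mx : 'M[fps F]_n :=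
  \matrix_(i, j) Fps (fun k => (W ^+ k) i j).

Lemma fps_coef_mul_resolvent i j k :
  fps_coef ((uW *m resolvent_mx) i j) k = if k == 0%N then 0 else (W ^+ k) i j.
Proof.
rewrite mxE fps_coef_sum; under eq_bigr do rewrite !mxE -mulrA fps_coefXM.
case: k => [|k]; first by rewrite big1.
by rewrite exprS mxE; apply: eq_bigr => l _; rewrite fps_coefCM.
Qed.

Lemma mul_resolvent_mx : char_series_mx *m resolvent_mx = 1%:M.
Proof.
rewrite /char_series_mx mulmxBl mul1mx; apply/matrixP => i j; apply: fpsP => k.
rewrite [in LHS]mxE fps_coefD [X in _ + fps_coef X k]mxE fps_coefN.
rewrite fps_coef_mul_resolvent !mxE fps_coefMn fps_coef1 /fps_coef /=.
by case: k => [|k]; rewrite ?subr0 ?subrr ?mul0rn // expr0 mxE.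
Qed.

Lemma char_series_mx_unit : char_series_mx \in unitmx.
Proof. by case: (mulmx1_unit mul_resolvent_mx). Qed.

Lemma char_series_unit : char_series \is a GRing.unit.
Proof. by rewrite -unitmxE char_series_mx_unit. Qed.

Lemma invmx_char_series_mx : invmx char_series_mx = resolvent_mx.
Proof.
by rewrite -[RHS](mulKmx char_series_mx_unit) mul_resolvent_mx mulmx1.
Qed.

Lemma logderiv_char_series :
  logderiv fps_xderiv char_series = - trace_series.
Proof.
have xderivE : map_mx fps_xderiv char_series_mx = - uW.
  apply/matrixP => i j; rewrite !mxE raddfB /=.
  rewrite (derivation_nat fps_xderivM) sub0r fps_xderivM.
  by rewrite fps_xderivC mulr0 addr0 fps_xderivX.
rewrite (logderiv_det fps_xderivM char_series_mx_unit) invmx_char_series_mx.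
rewrite /= xderivE mulNmx raddfN /=; congr (- _); apply: fpsP => k.
rewrite fps_coef_sum; under eq_bigr do rewrite fps_coef_mul_resolvent.
by rewrite /trace_series /fps_coef; case: eqP => // _; rewrite big1.
Qed.

Lemma fps_coef0_char_series : fps_coef char_series 0 = 1.
Proof.
rewrite -[LHS]/(fps_const _) -det_map_mx -[RHS](det1 F n); congr (\det _).
apply/matrixP => i j; rewrite !mxE /= raddfB /= rmorph_nat rmorphM /=.
by rewrite [fps_const fpsX]fps_coefX mul0r subr0.
Qed.
End CharacteristicSeries.

Lemma char_series_tr (F : fieldType) n (W : 'M[F]_n) :
  char_series W^T = char_series W.
Proof.
rewrite /char_series -[RHS]det_tr /char_series_mx; congr (\det _).
by apply/matrixP => i j; rewrite !mxE eq_sym.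
Qed.

Section Words.
Variable T : Type.
Implicit Types (s u v : seq T) (l m : nat).

Definition word_pow s l := flatten (nseq l s).

Lemma size_word_pow s l : size (word_pow s l) = (l * size s)%N.
Proof. by elim: l => //= l IHl; rewrite size_cat IHl mulSn. Qed.

Lemma word_powS s l : word_pow s l.+1 = s ++ word_pow s l.
Proof. by []. Qed.

Lemma word_pow0s l : word_pow [::] l = [::].
Proof. by elim: l. Qed.

Lemma word_pow1 s : word_pow s 1 = s.
Proof. exact: cats0. Qed.

Lemma word_powD s l m : word_pow s (l + m) = word_pow s l ++ word_pow s m.
Proof. by rewrite /word_pow nseqD flatten_cat. Qed.

Lemma word_powM s l m : word_pow (word_pow s l) m = word_pow s (m * l).
Proof. by elim: m => //= m IHm; rewrite mulSn word_powD -IHm. Qed.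

Lemma word_pow_cat_shift u v l :
  word_pow (u ++ v) l ++ u = u ++ word_pow (v ++ u) l.
Proof. by elim: l => [|l IHl]; rewrite ?cats0 // !word_powS -!catA IHl. Qed.

Lemma rot_word_pow i s l : (i <= size s)%N ->
  rot i (word_pow s l) = word_pow (rot i s) l.
Proof.
move=> le_is; case: l => // l; rewrite -{1}[s](cat_take_drop i) word_powS -catA.
have {1}-> : i = size (take i s) by rewrite size_takel.
by rewrite rot_size_cat -catA word_pow_cat_shift catA.
Qed.

Lemma rot_word_pow_exists i s l :
  exists s', rot i (word_pow s l) = word_pow s' l.
Proof.
elim: i => [|i [s' IHi]]; first by exists s; rewrite rot0.
have [lt_i|le_i] := ltnP i (size (word_pow s l)); last first.
  by exists s; rewrite rot_oversize // ltnW.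
exists (rot 1 s'); rewrite rotS // IHi; case: s' {IHi} => [|x s'].
  by rewrite word_pow0s.
by rewrite rot_word_pow.
Qed.

Lemma commuting_words_pow u v : u ++ v = v ++ u ->
  exists s l m, u = word_pow s l /\ v = word_pow s m.
Proof.
have [n] := ubnP (size u + size v)%N; elim: n u v => // n IHn u v lt_n uv.
wlog le_uv : u v lt_n uv / (size u <= size v)%N.
  move=> wlog_uv; have [|/ltnW] := leqP (size u) (size v); first exact: wlog_uv.
  by case/wlog_uv=> [||s [l [m [vE uE]]]]; rewrite 1?addnC //; exists s, m, l.
have [/size0nil-> | u_gt0] := posnP (size u).
  by exists v, 0%N, 1%N; rewrite word_pow1.
have vE : v = u ++ drop (size u) v.
  rewrite -{1}[v](cat_take_drop (size u)); congr (_ ++ _).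
  by have /(congr1 (take (size u))) := uv; rewrite take_size_cat // takel_cat.
move: (drop _ v) vE => v' vE; rewrite vE in lt_n uv *.
have uv' : u ++ v' = v' ++ u.
  by have /(congr1 (drop (size u))) := uv; rewrite -catA !drop_size_cat.
have [|s [l [m [uE v'E]]]] := IHn _ _ _ uv'.
  rewrite -ltnS (leq_trans _ lt_n) // size_cat ltnS.
  by rewrite -[ltnLHS]add0n ltn_add2r.
by exists s, l, (l + m)%N; rewrite word_powD -uE -v'E.
Qed.

Lemma word_pow_eq_comm u v l m : (0 < l)%N -> (0 < m)%N ->
  word_pow u l = word_pow v m -> u ++ v = v ++ u.
Proof.
(* uv and vu are prefixes of the same length of the square of u^l = v^m. *)
have prefix a b i j : word_pow a i.+1 = word_pow b j.+1 ->
    a ++ b = take (size a + size b) (word_pow a i.+1 ++ word_pow a i.+1).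
  move=> ab; have -> : word_pow a i.+1 ++ word_pow a i.+1 =
      (a ++ b) ++ word_pow b j ++ word_pow a i.
    by rewrite -word_powD addSn addnC word_powS word_powD ab word_powS -!catA.
  by rewrite -size_cat take_size_cat.
case: l m => [|l] // [|m] // _ _ uv.
by rewrite (prefix u v l m) // (prefix v u m l) // addnC uv.
Qed.

Definition primitive_word s : Prop :=
  (0 < size s)%N /\ forall u l, s = word_pow u l -> l = 1%N.

Lemma primitive_root_exists s : (0 < size s)%N ->
  exists u l, primitive_word u /\ s = word_pow u l.
Proof.
have [n] := ubnP (size s); elim: n s => // n IHn s lt_sn s_gt0.
have [prim_s|nprim_s] := pselect (primitive_word s).
  by exists s, 1%N; rewrite word_pow1.
have [u [l [sE l_neq1]]] : exists u l, s = word_pow u l /\ l <> 1%N.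
  apply: contrapT => no_root; apply: nprim_s; split=> // u l sE.
  by apply: contrapT => l_neq1; apply: no_root; exists u, l.
move: (s_gt0); rewrite {1}sE size_word_pow muln_gt0 => /andP[l_gt0 u_gt0].
have [|v [m [prim_v uE]]] := IHn u _ u_gt0.
  rewrite -ltnS (leq_trans _ lt_sn) // ltnS sE size_word_pow ltn_Pmull //.
  by case: l l_gt0 l_neq1 {sE} => [|[|l]].
by exists v, (l * m)%N; rewrite -word_powM -uE.
Qed.

Lemma commuting_primitive_eq u v :
  primitive_word u -> primitive_word v -> u ++ v = v ++ u -> u = v.
Proof.
move=> [_ prim_u] [_ prim_v] /commuting_words_pow[s [l [m [uE vE]]]].
by rewrite uE vE (prim_u s l) // (prim_v s m).
Qed.

Lemma primitive_root_uniq u v l m : primitive_word u -> primitive_word v ->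
  (0 < l)%N -> (0 < m)%N -> word_pow u l = word_pow v m -> u = v.
Proof.
move=> prim_u prim_v l_gt0 m_gt0 /(word_pow_eq_comm l_gt0 m_gt0).
exact: commuting_primitive_eq.
Qed.

Lemma primitive_word_rot i s : primitive_word s -> primitive_word (rot i s).
Proof.
move=> [s_gt0 prim_s]; split=> [|v l rotE]; first by rewrite size_rot.
have [v' v'E] := rot_word_pow_exists (size s - i) v l.
by apply: (prim_s v'); rewrite -v'E -rotE -(size_rot i s) -/(rotr i _) rotK.
Qed.

Lemma primitive_rot_fixed i s : primitive_word s -> (i < size s)%N ->
  rot i s = s -> i = 0%N.
Proof.
move=> [_ prim_s] lt_is rot_s.
have /commuting_words_pow[u [l [m [takeE dropE]]]] :
  take i s ++ drop i s = drop i s ++ take i s by rewrite cat_take_drop.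
have lm1 : (l + m = 1)%N.
  by apply: (prim_s u); rewrite word_powD -takeE -dropE cat_take_drop.
have m_gt0 : (0 < m)%N.
  have : (0 < size (drop i s))%N by rewrite size_drop subn_gt0.
  by rewrite dropE size_word_pow muln_gt0 => /andP[].
have l0 : l = 0%N by case: l m m_gt0 lm1 {takeE dropE} => [|[|l]] [|m].
by rewrite -(size_takel (ltnW lt_is)) takeE l0.
Qed.

Lemma primitive_rot_inj s : primitive_word s ->
  {in gtn (size s) &, injective (fun i => rot i s)}.
Proof.
move=> prim_s i j lt_i lt_j; wlog le_ij : i j lt_i lt_j / (i <= j)%N.
  move=> wlog_ij rot_ij; have [/wlog_ij|/ltnW/wlog_ij] := leqP i j; first exact.
  by move->.
rewrite !inE in lt_i lt_j => rot_ij; apply/eqP; rewrite eqn_leq le_ij -subn_eq0.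
apply/eqP/(@primitive_rot_fixed _ (rot i s)).
- exact: primitive_word_rot.
- by rewrite size_rot (leq_ltn_trans (leq_subr _ _)).
- by rewrite -rotD subnK // ltnW.
Qed.
End Words.

Lemma big_tuple_cons (R : Type) (idx : R) (op : Monoid.com_law idx)
    (T : finType) k (E : k.+1.-tuple T -> R) :
  \big[op/idx]_(t : k.+1.-tuple T) E t =
  \big[op/idx]_(x : T) \big[op/idx]_(s : k.-tuple T) E [tuple of x :: s].
Proof.
pose tcons (p : T * k.-tuple T) := [tuple of p.1 :: p.2].
pose tuncons (t : k.+1.-tuple T) := (thead t, [tuple of behead t]).
rewrite pair_big /= (reindex tcons) //=; exists tuncons => [[x s] _|t _].
  by congr pair; apply: val_inj.
by rewrite /tcons -tuple_eta.
Qed.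

Section WalkWeights.
Variables (R : comPzRingType) (T : Type) (w : T -> T -> R).

Definition walk_weight x (s : seq T) y : R :=
  \prod_(p <- zip (x :: s) (rcons s y)) w p.1 p.2.

Definition closed_walk_weight (s : seq T) : R :=
  \prod_(p <- zip s (rot 1 s)) w p.1 p.2.

Lemma walk_weight_cons x z s y :
  walk_weight x (z :: s) y = w x z * walk_weight z s y.
Proof. exact: big_cons. Qed.

Lemma closed_walk_weight_cons x s :
  closed_walk_weight (x :: s) = walk_weight x s x.
Proof. by rewrite /closed_walk_weight rot1_cons. Qed.

Lemma walk_weight_eq0 (e : rel T) x s y :
    (forall a b, ~~ e a b -> w a b = 0) ->
  ~~ path e x (rcons s y) -> walk_weight x s y = 0.
Proof.
move=> w0; elim: s x => [|z s IHs] x /=.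
  by rewrite andbT => /w0 wxy; rewrite /walk_weight big_seq1.
rewrite walk_weight_cons negb_and => /orP[/w0-> | /IHs->].
  by rewrite mul0r.
by rewrite mulr0.
Qed.

Lemma closed_walk_weight_eq0 (e : rel T) s :
    (forall a b, ~~ e a b -> w a b = 0) ->
  ~~ path.cycle e s -> closed_walk_weight s = 0.
Proof.
case: s => // x s w0; rewrite closed_walk_weight_cons.
exact: walk_weight_eq0.
Qed.

Lemma closed_walk_weight_pow s l :
  closed_walk_weight (word_pow s l) = closed_walk_weight s ^+ l.
Proof.
rewrite /closed_walk_weight; have [/size0nil-> | s_gt0] := posnP (size s).
  by rewrite word_pow0s /= big_nil expr1n.
rewrite rot_word_pow //; elim: l => [|l IHl]; first by rewrite big_nil.
by rewrite !word_powS zip_cat ?size_rot // big_cat IHl exprS.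
Qed.
End WalkWeights.

Section WeightMatrix.
Variables (R : comPzRingType) (T : finType) (w : T -> T -> R).

Definition weight_mx : 'M[R]_#|T| :=
  \matrix_(i, j) w (enum_val i) (enum_val j).

Lemma weight_mxX k x y :
  (weight_mx ^+ k.+1) (enum_rank x) (enum_rank y) =
  \sum_(s : k.-tuple T) walk_weight w x s y.
Proof.
elim: k x => [|k IHk] x.
  rewrite expr1 mxE !enum_rankK (big_pred1 [tuple]) => [|s]; last first.
    by apply/esym/eqP/tuple0.
  by rewrite /walk_weight big_seq1.
rewrite exprS mxE big_tuple_cons (reindex (@enum_rank T)) /=; last first.
  by apply: onW_bij; apply: enum_rank_bij.
apply: eq_bigr => z _; rewrite IHk mulr_sumr mxE !enum_rankK.
by apply: eq_bigr => s _; rewrite walk_weight_cons.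
Qed.

Lemma trace_weight_mxX k :
  \tr (weight_mx ^+ k.+1) = \sum_(t : k.+1.-tuple T) closed_walk_weight w t.
Proof.
rewrite big_tuple_cons /mxtrace (reindex (@enum_rank T)) /=; last first.
  by apply: onW_bij; apply: enum_rank_bij.
apply: eq_bigr => x _; rewrite weight_mxX; apply: eq_bigr => s _.
by rewrite closed_walk_weight_cons.
Qed.
End WeightMatrix.

Section PrimeCycles.
Variable G : sgraph.
Implicit Types (C : seq (darc G)) (c : primeClass G).

Lemma is_cycle_pow C l : (0 < l)%N -> is_cycle (word_pow C l) = is_cycle C.
Proof.
case: C l => [|x s] [|l] // _; first by rewrite word_pow0s.
rewrite /is_cycle word_powS /=; elim: l => [|l IHl]; first by rewrite cats0.
by rewrite /= rcons_cat rcons_cons -cat_rcons cat_path last_rcons IHl andbb.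
Qed.

Lemma is_cycle_rot i C : is_cycle (rot i C) = is_cycle C.
Proof. by rewrite /is_cycle rot_cycle -!size_eq0 size_rot. Qed.

Lemma is_cycle_gt0 C : is_cycle C -> (0 < size C)%N.
Proof. by case: C. Qed.

Lemma prime_cycleP C : prime_cycle C <-> is_cycle C /\ primitive_word C.
Proof.
split=> [[cycC primeC] | [cycC [_ primC]]]; split=> //.
  split=> [| u [|[|l]] CE //]; first exact: is_cycle_gt0.
    by move: cycC; rewrite CE.
  case: primeC; exists u, l.+2; split=> //.
  by rewrite -(is_cycle_pow u (ltn0Sn l.+1)) -CE.
by case=> B [l [_ + CE]]; rewrite (primC B l CE).
Qed.

Lemma class_rep_cycle c : is_cycle (class_rep c).
Proof. by have /asboolP/prime_cycleP[] := valP (repr c). Qed.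

Lemma class_rep_primitive c : primitive_word (class_rep c).
Proof. by have /asboolP/prime_cycleP[] := valP (repr c). Qed.

Lemma class_rep_gt0 c : (0 < size (class_rep c))%N.
Proof. exact/is_cycle_gt0/class_rep_cycle. Qed.

Lemma prime_cycle_rot_class C : prime_cycle C ->
  exists c i, (i < size (class_rep c))%N /\ C = rot i (class_rep c).
Proof.
move=> /asboolP pC; pose C' : primeCycle G := exist _ C pC.
pose c := (\pi_(primeClass G) C')%qT.
have /asboolP[i /= CE] : cycle_equiv (repr c) C'.
  by apply/eqmodP; rewrite reprK.
exists c; have [lt_i|le_i] := ltnP i (size (class_rep c)); first by exists i.
by exists 0%N; rewrite class_rep_gt0 CE rot0 rot_oversize.
Qed.

Lemma rot_class_rep_eq c c' i j :
  rot i (class_rep c) = rot j (class_rep c') -> c = c'.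
Proof.
move=> rot_ij; rewrite -[c]reprK -[c']reprK; apply/eqmodP/asboolP.
exists (rot_add (class_rep c) i (size (class_rep c') - j)).
rewrite -rot_rot_add // rot_ij -(size_rot j (class_rep c')).
by rewrite -/(rotr _ _) rotK.
Qed.

(* This has length k only when the length of c divides k. *)
Definition class_walk k c i : seq (darc G) :=
  word_pow (rot i (class_rep c)) (k %/ size (class_rep c)).

Section ClassWalks.
Variable k : nat.
Hypothesis k_gt0 : (0 < k)%N.

Lemma class_walk_exponent_gt0 c : (size (class_rep c) %| k)%N ->
  (0 < k %/ size (class_rep c))%N.
Proof. by move=> c_dvd; rewrite divn_gt0 ?class_rep_gt0 // dvdn_leq. Qed.

Lemma size_class_walk c i : (size (class_rep c) %| k)%N ->
  size (class_walk k c i) = k.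
Proof. by move=> c_dvd; rewrite size_word_pow size_rot divnK. Qed.

Lemma class_walk_cycle c i : (size (class_rep c) %| k)%N ->
  is_cycle (class_walk k c i).
Proof.
move=> c_dvd; rewrite is_cycle_pow ?class_walk_exponent_gt0 //.
by rewrite is_cycle_rot class_rep_cycle.
Qed.

Lemma cycle_class_walk C : is_cycle C -> size C = k -> exists c i,
  [/\ (size (class_rep c) %| k)%N, (i < size (class_rep c))%N &
      C = class_walk k c i].
Proof.
move=> cycC szC.
have [u [l [prim_u CE]]] := primitive_root_exists (is_cycle_gt0 cycC).
have szk : (l * size u)%N = k by rewrite -size_word_pow -CE.
have l_gt0 : (0 < l)%N by move: k_gt0; rewrite -szk muln_gt0 => /andP[].
have [|c [i [lt_i uE]]] := @prime_cycle_rot_class u.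
  by apply/prime_cycleP; rewrite -(is_cycle_pow u l_gt0) -CE.
have szu : size u = size (class_rep c) by rewrite uE size_rot.
exists c, i; split=> //; first by rewrite -szk szu dvdn_mull.
by rewrite /class_walk -uE -szk szu mulnK ?class_rep_gt0.
Qed.

Lemma class_walk_inj c c' i j :
    (size (class_rep c) %| k)%N -> (size (class_rep c') %| k)%N ->
    (i < size (class_rep c))%N -> (j < size (class_rep c'))%N ->
  class_walk k c i = class_walk k c' j -> c = c' /\ i = j.
Proof.
move=> c_dvd c'_dvd lt_i lt_j.
have prim_rot (a : primeClass G) m : primitive_word (rot m (class_rep a)).
  exact/primitive_word_rot/class_rep_primitive.
move/(primitive_root_uniq (prim_rot _ _) (prim_rot _ _)
  (class_walk_exponent_gt0 c_dvd) (class_walk_exponent_gt0 c'_dvd)) => rot_ij.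
have cc' := rot_class_rep_eq rot_ij; split=> //; rewrite -{}cc' in lt_j rot_ij.
by apply: primitive_rot_inj rot_ij => //; exact: class_rep_primitive.
Qed.

Variable S : seq (primeClass G).
Hypothesis uniqS : uniq S.
Hypothesis short_in_S : forall c, (size (class_rep c) <= k)%N -> c \in S.

Lemma perm_cycles_class_walks :
  perm_eq [seq val t | t in [pred t : k.-tuple (darc G) | is_cycle t]]
    [seq class_walk k c i | c <- [seq c <- S | (size (class_rep c) %| k)%N],
                            i <- iota 0 (size (class_rep c))].
Proof.
apply: uniq_perm.
- by rewrite map_inj_uniq ?enum_uniq //; exact: val_inj.
- apply: allpairs_uniq_dep => [|c _|]; rewrite ?filter_uniq ?iota_uniq //.
  move=> _ _ /allpairsPdep[c [i [+ + ->]]] /allpairsPdep[c' [j [+ + ->]]] /=.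
  rewrite !mem_filter !mem_iota => /andP[c_dvd _] lt_i /andP[c'_dvd _] lt_j.
  by case/(class_walk_inj c_dvd c'_dvd lt_i lt_j) => -> ->.
- move=> C; apply/mapP/allpairsPdep => [[t] | [c [i [+ _ CE]]]].
    rewrite mem_enum => cyc_t ->.
    have [c [i [c_dvd lt_i tE]]] := cycle_class_walk cyc_t (size_tuple t).
    exists c, i; rewrite mem_filter c_dvd mem_iota lt_i short_in_S //.
    exact: dvdn_leq.
  rewrite mem_filter => /andP[c_dvd _].
  have szC : size (class_walk k c i) == k by rewrite size_class_walk.
  by exists (Tuple szC); rewrite // mem_enum inE /= class_walk_cycle.
Qed.

Lemma sum_cycles_class_walks (V : nmodType) (f : seq (darc G) -> V) :
  \sum_(t : k.-tuple (darc G) | is_cycle t) f t =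
  \sum_(c <- S | (size (class_rep c) %| k)%N)
    \sum_(i < size (class_rep c)) f (class_walk k c i).
Proof.
rewrite -big_image (perm_big _ perm_cycles_class_walks) /=.
rewrite big_allpairs_dep big_filter; apply: eq_bigr => c _.
by rewrite -(big_mkord xpredT (f \o class_walk k c)) /index_iota subn0.
Qed.
End ClassWalks.

Lemma finite_short_classes n : exists S : {fset primeClass G},
  forall c, (size (class_rep c) <= n)%N -> c \in S.
Proof.
pose short_words := [seq val t | l <- iota 0 n.+1,
                                 t <- enum {: l.-tuple (darc G)}].
pose class_of C : option (primeClass G) :=
  omap (fun C' : primeCycle G => \pi_(primeClass G) C')%qT (insub C).
exists [fset c in pmap class_of short_words]%fset => c le_cn.
rewrite inE mem_pmap; apply/mapP; exists (class_rep c); last first.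
  by rewrite /class_of valK /= reprK.
apply/allpairsPdep; exists (size (class_rep c)), (in_tuple (class_rep c)).
by rewrite mem_iota mem_enum.
Qed.
End PrimeCycles.

Section Zeta.
Variables (R : realType) (G : sgraph) (theta : darc G -> R[i]).
Implicit Types (C : seq (darc G)) (c : primeClass G).

Let W := weight_mx (arc_weight theta).

Lemma inv_arcK : involutive (@inv_arc G).
Proof. by move=> e; apply: val_inj; rewrite /= -surjective_pairing. Qed.

Lemma grover_entryE e f : grover_entry theta e f = arc_weight theta f e.
Proof.
rewrite /grover_entry /arc_weight.
by rewrite -[f == inv_arc e](can_eq inv_arcK) inv_arcK [e == _]eq_sym.
Qed.

Lemma twisted_zetaE : twisted_zeta theta = (char_series W)^-1.
Proof.
rewrite -[LHS]/((char_series (grover_mx theta))^-1) -(char_series_tr W).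
by congr (char_series _)^-1; apply/matrixP => i j; rewrite !mxE grover_entryE.
Qed.

Lemma twisted_zeta_unit : twisted_zeta theta \is a GRing.unit.
Proof. by rewrite twisted_zetaE unitrV char_series_unit. Qed.

Lemma fps_coef0_twisted_zeta : fps_coef (twisted_zeta theta) 0 = 1.
Proof.
rewrite -[LHS]/(fps_const _) twisted_zetaE rmorphV ?char_series_unit //=.
by rewrite /fps_const fps_coef0_char_series invr1.
Qed.

Lemma arc_weight_eq0 e f : tgt e != org f -> arc_weight theta e f = 0.
Proof.
rewrite /arc_weight => /negPf ef; rewrite ef /=.
by case: eqP => // fE; rewrite fE eqxx in ef.
Qed.

Lemma cycle_weight_eq0 C :
  (0 < size C)%N -> ~~ is_cycle C -> cycle_weight theta C = 0.
Proof.
case: C => // e s _; exact: (closed_walk_weight_eq0 arc_weight_eq0).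
Qed.

Lemma cycle_weight_pow C l :
  cycle_weight theta (word_pow C l) = cycle_weight theta C ^+ l.
Proof. exact: closed_walk_weight_pow. Qed.

Lemma cycle_sum_trace k : cycle_sum theta k.+1 = \tr (W ^+ k.+1).
Proof.
rewrite trace_weight_mxX /cycle_sum big_mkcond; apply: eq_bigr => t _.
rewrite -[RHS]/(cycle_weight theta t).
by case: ifPn => // /cycle_weight_eq0-> //; rewrite size_tuple.
Qed.

Lemma fps_coef_xderiv_cycle_sum k : (0 < k)%N ->
  fps_coef (fps_xderiv (cycle_sum_series theta)) k = cycle_sum theta k.
Proof.
move=> k_gt0; rewrite fps_coef_xderiv /fps_coef /= (gtn_eqF k_gt0).
by rewrite mulrC divfK // pnatr_eq0 -lt0n.
Qed.

Lemma xderiv_cycle_sum_series_trace :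
  fps_xderiv (cycle_sum_series theta) = trace_series W.
Proof.
apply: fpsP => -[|k]; first by rewrite fps_coef_xderiv mul0r.
by rewrite fps_coef_xderiv_cycle_sum // cycle_sum_trace.
Qed.

Lemma logderiv_twisted_zeta :
  logderiv fps_xderiv (twisted_zeta theta) =
  fps_xderiv (cycle_sum_series theta).
Proof.
rewrite twisted_zetaE (logderivV fps_xderivM (char_series_unit W)).
by rewrite /= logderiv_char_series opprK xderiv_cycle_sum_series_trace.
Qed.

Lemma cycle_sum_classes k (S : seq (primeClass G)) :
    (0 < k)%N -> uniq S ->
    (forall c, (size (class_rep c) <= k)%N -> c \in S) ->
  cycle_sum theta k =
  \sum_(c <- S | (size (class_rep c) %| k)%N)
    cycle_weight theta (class_rep c) ^+ (k %/ size (class_rep c))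
      *+ size (class_rep c).
Proof.
move=> k_gt0 uniqS short_in_S.
rewrite /cycle_sum (sum_cycles_class_walks k_gt0 uniqS short_in_S).
apply: eq_bigr => c _; rewrite -[in RHS](card_ord (size (class_rep c))).
rewrite -sumr_const; apply: eq_bigr => i _.
by rewrite cycle_weight_pow cycle_weight_rot card_ord.
Qed.

Lemma euler_factorE c :
  euler_factor theta c =
  fps_geom (cycle_weight theta (class_rep c)) (size (class_rep c)).
Proof. exact/invr_one_sub_CXn/class_rep_gt0. Qed.

Lemma euler_factor_unit c : euler_factor theta c \is a GRing.unit.
Proof. by rewrite unitrV one_sub_CXn_unit ?class_rep_gt0. Qed.

Lemma fps_coef0_prod_euler_factor (S : seq (primeClass G)) :
  fps_coef (\prod_(c <- S) euler_factor theta c) 0 = 1.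
Proof.
rewrite -[LHS]/(fps_const _) rmorph_prod big1 //= => c _.
by rewrite euler_factorE /fps_const /fps_coef /= dvdn0 div0n.
Qed.

Lemma fps_coef_logderiv_prod_euler_factor k (S : seq (primeClass G)) :
    uniq S -> (forall c, (size (class_rep c) <= k)%N -> c \in S) ->
  fps_coef (logderiv fps_xderiv (\prod_(c <- S) euler_factor theta c)) k =
  fps_coef (fps_xderiv (cycle_sum_series theta)) k.
Proof.
move=> uniqS short_in_S; have [-> | k_gt0] := posnP k.
  by rewrite fps_coef0_logderiv fps_coef_xderiv mul0r.
rewrite fps_coef_xderiv_cycle_sum //.
rewrite (logderiv_prod fps_xderivM _ euler_factor_unit) fps_coef_sum.
rewrite (cycle_sum_classes k_gt0 uniqS short_in_S) [RHS]big_mkcond.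
apply: eq_bigr => c _; rewrite euler_factorE.
by rewrite fps_coef_logderiv_geom ?class_rep_gt0.
Qed.
End Zeta.

Theorem theorem10 (R : realType) (G : sgraph) (A : {set G * G})
    (theta : darc G -> R[i])
    (Gconn : connected_graph G)
    (A_arcs : A :|: rev_arcs A = arcs G)
    (theta_inv : forall e : darc G, val e \in A ->
       theta (inv_arc e) = - theta e)
    (theta_bi : forall e : darc G, val e \in A :&: rev_arcs A ->
       theta e = 0) :
  fps_is_prod (euler_factor theta) (twisted_zeta theta) /\
  twisted_zeta theta = fps_exp (cycle_sum_series theta).
Proof.
have F0 : [pchar R[i]] =i pred0 := pchar_num _.
have zeta0 := fps_coef0_twisted_zeta theta.
have zeta_unit := twisted_zeta_unit theta.
split; last first.
  apply: fps_logderiv_inj => //; first by rewrite fps_coef0_exp.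
  by rewrite logderiv_twisted_zeta logderiv_exp.
move=> n; have [S0 short_in_S0] := finite_short_classes G n.
exists S0 => S /fsubsetP sS0S; apply/esym/fps_coef_eq_logderiv => //.
  by rewrite fps_coef0_prod_euler_factor.
move=> k le_kn; rewrite logderiv_twisted_zeta.
rewrite (fps_coef_logderiv_prod_euler_factor _ (fset_uniq S)) // => c le_ck.
exact/sS0S/short_in_S0/(leq_trans le_ck).
Qed.
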